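(* Let $n\ge 0$ and $t\ge 0$ be integers, let $p_1,\dots,p_{t+1}$ be primes (not necessarily distinct), and let $j$ be an integer with $p_{t+1}\nmid j$. Then the following hold (for $t=0$ the product $p_1^2\cdots p_t^2$ is $1$). (i) If $p_i\equiv 2\pmod 3$ for all $i\in\{1,\dots,t+1\}$, then $$B_3^{(12)}\left(3p_1^2\cdots p_{t+1}^2n+\left(p_1^2\cdots p_t^2p_{t+1}(p_{t+1}+3j)-1\right)\right)\equiv 0\pmod 3.$$ (ii) If $p_i\ne 3$ and $p_i\equiv 3\pmod 4$ for all $i\in\{1,\dots,t+1\}$, then $$B_3^{(15)}\left(3p_1^2\cdots p_{t+1}^2n+\frac{p_1^2\cdots p_t^2p_{t+1}(5p_{t+1}+12j)-5}{4}\right)\equiv 0\pmod 3.$$ (iii) If $p_i\neq 5$ and $p_i\equiv 2\pmod 3$ for all $i\in\{1,\dots,t+1\}$, then $$B_5^{(10)}\left(5p_1^2\cdots p_{t+1}^2n+\frac{5\left(p_1^2\cdots p_t^2p_{t+1}(p_{t+1}+3j)-1\right)}{3}\right)\equiv 0\pmod 5.$$ (iv) If $p_i\neq 7$ and $p_i\equiv 3\pmod 4$ for all $i\in\{1,\dots,t+1\}$, then $$B_7^{(7)}\left(7p_1^2\cdots p_{t+1}^2n+\frac{7\left(p_1^2\cdots p_t^2p_{t+1}(p_{t+1}+4j)-1\right)}{4}\right)\equiv 0\pmod 7.$$ (v) If $p_i\notin\{3,11\}$ and $p_i\equiv 3\pmod 4$ for all $i\in\{1,\dots,t+1\}$, then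 $$B_{11}^{(11)}\left(11p_1^2\cdots p_{t+1}^2n+\frac{11\left(p_1^2\cdots p_t^2p_{t+1}(5p_{t+1}+12j)-5\right)}{12}\right)\equiv 0\pmod{11}.$$
   Context: For positive integers $\ell,r$ and an integer $n\ge 0$, $B_\ell^{(r)}(n)$ denotes the number of $\ell$-regular $r$-multipartitions of $n$, i.e. ordered $r$-tuples $(\lambda^{(1)},\dots,\lambda^{(r)})$ of (possibly empty) integer partitions, each having no part divisible by $\ell$, whose sizes sum to $n$; $B_\ell^{(r)}(0)=1$. Equivalently, as formal power series, $$\sum_{n=0}^\infty B_\ell^{(r)}(n)q^n=\frac{E_\ell^r}{E_1^r},\qquad E_k:=\prod_{m=1}^\infty(1-q^{km}).$$ By convention $B_\ell^{(r)}(m)=0$ for negative integers $m$. *)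

(* Defs.v *)
From HB Require Import structures.
From mathcomp Require Import all_boot all_order all_algebra.

Set Implicit Arguments.
Unset Strict Implicit.
Unset Printing Implicit Defensive.

Import Order.TTheory GRing.Theory Num.Theory.

Definition is_partition (s : seq nat) : bool := sorted geq s && (0 \notin s).

Definition regular_partition (l : nat) (s : seq nat) : bool :=
  is_partition s && all (fun k => ~~ (l %| k)) s.

Definition regular_multipartition (l r n : nat) (L : r.-tuple (seq nat)) : bool :=
  all (regular_partition l) L && (\sum_(s <- L) sumn s == n).

Definition bseq_parts (n : nat) (s : n.-bseq 'I_n.+1) : seq nat :=
  [seq val k | k <- s].

(* The components of a multipartition of n have at most n parts, each at most  *)
(* n, so they all live in the finite type n.-bseq 'I_n.+1; see card_multipart. *)
Definition multipart (l r n : nat) : nat :=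
  #|[set L : r.-tuple (n.-bseq 'I_n.+1) |
      regular_multipartition l n (map_tuple (@bseq_parts n) L)]|.

Definition multipartz (l r : nat) (m : int) : nat :=
  if m is Posz n then multipart l r n else 0.

Lemma bseq_parts_inj n : injective (@bseq_parts n).
Proof. by move=> s1 s2 /(inj_map val_inj) /val_inj. Qed.

Lemma size_partition s : is_partition s -> size s <= sumn s.
Proof.
case/andP=> _; elim: s => //= x s IHs; rewrite inE negb_or => /andP[x0 /IHs le_s].
by rewrite -add1n leq_add // lt0n eq_sym.
Qed.

Lemma mem_leq_sumn (s : seq nat) k : k \in s -> k <= sumn s.
Proof.
elim: s => //= x s IHs; rewrite inE => /orP[/eqP-> | /IHs le_k].
  exact: leq_addr.
exact: leq_trans le_k (leq_addl _ _).
Qed.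

Lemma bseq_parts_surj n s : is_partition s -> sumn s <= n ->
  exists u, @bseq_parts n u = s.
Proof.
move=> ps le_n.
have szs : size [seq inord k : 'I_n.+1 | k <- s] <= n.
  by rewrite size_map (leq_trans (size_partition ps)).
exists (Bseq szs); rewrite /bseq_parts /= -map_comp -[RHS]map_id.
apply/eq_in_map => k ks /=.
by rewrite inordK // ltnS (leq_trans (mem_leq_sumn ks)).
Qed.

Lemma card_multipart l r n (e : seq (r.-tuple (seq nat))) :
    uniq e -> (forall L, (L \in e) = regular_multipartition l n L) ->
  multipart l r n = size e.
Proof.
move=> Ue eP; rewrite /multipart cardE.
set f := map_tuple (@bseq_parts n); set A := enum _.
have f_inj : injective f.
  move=> L1 L2 /(congr1 val) /= /(inj_map (@bseq_parts_inj n)) eqL.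
  exact: val_inj.
rewrite -(size_map f); apply/perm_size/uniq_perm => //.
  by rewrite map_inj_uniq ?enum_uniq.
move=> L; rewrite eP; apply/mapP/idP => [[K] | LP].
  by rewrite mem_enum inE => KP ->.
have /andP[/allP regL /eqP sumL] := LP.
have le_n s : s \in val L -> sumn s <= n.
  by move=> sL; rewrite -sumL (big_rem s) //= leq_addr.
have surj s : s \in val L -> exists u, @bseq_parts n u == s.
  move=> sL; have /andP[ps _] := regL s sL.
  by have [u <-] := bseq_parts_surj ps (le_n s sL); exists u.
pose g s : n.-bseq 'I_n.+1 := odflt [bseq] [pick u | bseq_parts u == s].
have gK s : s \in val L -> bseq_parts (g s) = s.
  move=> /surj[u us]; rewrite /g; case: pickP => [v /eqP // | /(_ u)].
  by rewrite us.
have fgL : L = f (map_tuple g L).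
  apply: val_inj; rewrite /= -map_comp -[LHS]map_id.
  by apply/eq_in_map => s sL; rewrite /= gK.
by exists (map_tuple g L); rewrite // mem_enum inE -fgL.
Qed.

(* Main.v *)
Require Import Defs.
From HB Require Import structures.
From mathcomp Require Import all_boot all_order all_algebra.
From mathcomp Require Import finfield zify ring.

Set Implicit Arguments.
Unset Strict Implicit.
Unset Printing Implicit Defensive.

Import Order.TTheory GRing.Theory Num.Theory.
Local Open Scope ring_scope.

(** In characteristic p, E_p = E_1 ^ p, so the generating function of B_p^(r) is
    E_1 ^ ((p - 1) r) modulo p.  In all five cases (p - 1) r = p k with k one of 6,
    8, 10, and B_p^(r)(p N) is congruent to the coefficient of q^N in E_1 ^ k.
    That coefficient is 0 in characteristic 0 unless 8 N + 2 (k = 6) or 24 N + 10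
    (k = 10) is a sum of two squares, resp. 3 N + 1 (k = 8) is a norm from the
    Eisenstein integers; at the arguments of the theorem these numbers contain
    the inert prime p_(t+1) to an odd power.

    The lacunarity comes from Jacobi's T(z) = sum (-1)^i z^i q^(i (i-1) / 2), for
    which T(1) = 0 and T'(1) = - E_1 ^ 3.  In the A_2 product T(x) T(y) T(x y),
    the coefficient of x^m y^n is a one-dimensional theta series with quadratic
    term 3 k^2 / 2, which by the pentagonal number theorem is 0 or
    (+-) q^e(m, n) E_1.  Applying (x d/dx)^2 (y d/dy) at x = y = 1 and cancelling
    E_1 expresses E_1 ^ 8.  The B_2 product T(x) T(y) T(x y) T(x / y) and
    (x d/dx)^3 (y d/dy) do the same for E_1 ^ 10.

    All series live in a commutative ring containing x with x ^ M = 0 (in the end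
    the polynomials modulo X ^ M), so that sums over the integers become finite
    sums over [-B, B]. *)

(** * Sums over integer intervals and q-binomial coefficients *)

Definition tri (i : int) : nat :=
  match i with Posz n => 'C(n, 2) | Negz n => 'C(n.+2, 2) end.

Lemma triE i : (tri i)%:Z * 2 = i * (i - 1).
Proof.
have bin2z n : ('C(n.+1, 2))%:Z * 2 = n.+1%:Z * n%:Z.
  elim: n => [|n IHn] //; rewrite binS bin1 PoszD mulrDl IHn; lia.
by case: i => [[|n]|n]; rewrite /tri ?bin2z ?NegzE //; lia.
Qed.

(** Generalized pentagonal number k (3 k + 1) / 2, split so that it lives in [nat] without
    division. *)
Definition pent (k : int) : nat := (`|k| ^ 2 + tri (k + 1))%N.

Lemma pentE k : (pent k)%:Z * 2 = 3 * k ^+ 2 + k.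
Proof.
rewrite /pent PoszD mulrDl triE; have -> : (`|k| ^ 2)%N%:Z = k ^+ 2 by lia.
ring.
Qed.

Lemma odd_absD (a b : int) : odd `|a + b| = odd `|a| (+) odd `|b|.
Proof. lia. Qed.

Definition box (B : nat) : seq int := [seq i%:Z - B%:Z | i <- iota 0 B.*2.+1].

Lemma mem_box B k : (k \in box B) = (`|k| <= B)%N.
Proof.
apply/mapP/idP => [[i] | le_k]; first by rewrite mem_iota => ? ->; lia.
exists (absz (k + B%:Z)); first by rewrite mem_iota; lia.
lia.
Qed.

Lemma uniq_box B : uniq (box B).
Proof. by rewrite map_inj_uniq ?iota_uniq // => i j; lia. Qed.

Lemma sum_box (V : nmodType) B (F : int -> V) :
  \sum_(k <- box B) F k = \sum_(i < B.*2.+1) F (i%:Z - B%:Z).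
Proof. by rewrite /box big_map -[B.*2.+1 in LHS]subn0 -/(index_iota _ _) big_mkord. Qed.

(** The substitution permutes the integers, and [box B'] is large enough to contain the preimage of
    [box B], outside of which [F] vanishes. *)
Lemma sum_box_affine (V : nmodType) B B' (F : int -> V) (a d : int) :
    (`|d| = 1)%N -> (B + `|a| <= B')%N ->
    (forall k, (B < `|k|)%N -> F k = 0) ->
  \sum_(k <- box B') F (a + d * k) = \sum_(k <- box B) F k.
Proof.
move=> d1 leB F0.
have inj : injective (fun k => a + d * k) by move=> k l; nia.
rewrite -(big_map (fun k => a + d * k) xpredT F).
rewrite -(@big_rmcond _ _ _ _ _ (mem (box B))) => [|k]; last first.
  by rewrite [mem _ _]mem_box -ltnNge; apply: F0.
rewrite -big_filter; apply/perm_big/uniq_perm; last 1 first.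
- move=> k; rewrite mem_filter -[mem _ k]/(k \in box B) mem_box; apply/andP/idP => [[] // | le_k].
  split=> //; apply/mapP; exists (d * (k - a)); last nia.
  rewrite mem_box; nia.
- by apply: filter_uniq; rewrite map_inj_uniq // uniq_box.
- exact: uniq_box.
Qed.

Section QBinomial.

Variables (A : comNzRingType) (q : A).

Definition qfact n : A := \prod_(i < n) (1 - q ^+ i.+1).

Fixpoint qbin n k : A :=
  match n, k with
  | _, 0 => 1
  | 0, _.+1 => 0
  | n'.+1, k'.+1 => qbin n' k' + q ^+ k * qbin n' k
  end.

Lemma qbin0 n : qbin n 0 = 1. Proof. by case: n. Qed.

Lemma qbin_small n k : (n < k)%N -> qbin n k = 0.
Proof.
elim: n k => [|n IHn] [|k] //= lt_nk.
by rewrite !IHn ?mulr0 ?addr0 // ltnW.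
Qed.

(** The dual q-Pascal rule, used when [finite_jacobi] gains a factor [1 - z * q ^+ a]. *)
Lemma qbinS n k :
  (k <= n)%N -> qbin n.+1 k.+1 = qbin n k.+1 + q ^+ (n - k) * qbin n k.
Proof.
elim: n k => [|n IHn] k; first by case: k => //= _; ring.
case: k => [_|k le_kn].
  have {}IHn := IHn 0 isT; rewrite !subn0 in IHn *.
  rewrite -[LHS]/(qbin n.+1 0 + q ^+ 1 * qbin n.+1 1) [in LHS]IHn.
  by rewrite -[qbin n.+1 1]/(qbin n 0 + q ^+ 1 * qbin n 1) !qbin0 (exprS _ n); ring.
rewrite -[LHS]/(qbin n.+1 k.+1 + q ^+ k.+2 * qbin n.+1 k.+2).
move: le_kn; rewrite ltnS leq_eqVlt => /predU1P[->|lt_kn].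
  by rewrite [qbin _ n.+2]qbin_small // subnn; ring.
rewrite [qbin n.+1 k.+1 in LHS]IHn 1?ltnW // [qbin n.+1 k.+2 in LHS]IHn //.
rewrite -[qbin n.+1 k.+2 in RHS]/(qbin n k.+1 + q ^+ k.+2 * qbin n k.+2).
rewrite -[qbin n.+1 k.+1 in RHS]/(qbin n k + q ^+ k.+1 * qbin n k.+1).
rewrite subSS -(subnSK lt_kn) !(exprS q (n - k.+1)) (exprS q k.+1); ring.
Qed.

Lemma qbin_fact n k : qbin (n + k) k * qfact k * qfact n = qfact (n + k).
Proof.
have qfactS m : qfact m.+1 = qfact m * (1 - q ^+ m.+1) by rewrite /qfact big_ord_recr.
have qfact0 : qfact 0 = 1 by rewrite /qfact big_ord0.
elim: n k => [|n IHn] k.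
  suff -> : qbin (0 + k) k = 1 by rewrite qfact0 mul1r mulr1.
  by elim: k => //= k ->; rewrite qbin_small // mulr0 addr0.
elim: k => [|k IHk]; first by rewrite qbin0 qfact0 addn0 !mul1r.
have := IHn k.+1; move: IHk; rewrite !addSn !addnS.
rewrite -[qbin _.+2 k.+1]/(qbin (n + k).+1 k + q ^+ k.+1 * qbin (n + k).+1 k.+1).
move=> IHk E; rewrite [RHS]qfactS.
(* The two terms combine through 1 - q^(n+k+2) = (1 - q^(k+1)) + q^(k+1) (1 - q^(n+1)). *)
transitivity (qbin (n + k).+1 k * qfact k * qfact n.+1 * (1 - q ^+ k.+1)
    + q ^+ k.+1 * (qbin (n + k).+1 k.+1 * qfact k.+1 * qfact n * (1 - q ^+ n.+1))).
  by rewrite !qfactS; ring.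
by rewrite IHk E (_ : (n + k).+2 = k.+1 + n.+1)%N ?exprD; [ring | lia].
Qed.

End QBinomial.

(** * The pentagonal number theorem and Jacobi's triple product, finite forms *)

Lemma sum_boxS (V : nmodType) n (F : int -> V) :
  \sum_(k <- box n.+1) F k
    = \sum_(k <- box n) F k + F n.+1%:Z + F (- n.+1%:Z).
Proof.
rewrite !sum_box doubleS big_ord_recr big_ord_recl /= -addrA [LHS]addrC.
congr (_ + _ + _).
- by apply: eq_bigr => i _; congr F; rewrite /bump /=; lia.
- by congr F; lia.
- by congr F; lia.
Qed.

Lemma sum_box_eq (V : nmodType) M B (F : int -> V) : (M <= B)%N ->
    (forall k, (M < `|k|)%N -> F k = 0) ->
  \sum_(k <- box B) F k = \sum_(k <- box M) F k.
Proof.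
move=> leMB F0; rewrite -(@sum_box_affine _ M B F 0 1) ?addn0 //.
by apply: eq_bigr => k _; rewrite add0r mul1r.
Qed.

Lemma sum_boxN (V : nmodType) B (F : int -> V) :
  \sum_(k <- box B) F (- k) = \sum_(k <- box B) F k.
Proof.
rewrite -(big_map -%R xpredT F); apply/perm_big/uniq_perm.
- by rewrite map_inj_uniq ?uniq_box //; exact: oppr_inj.
- exact: uniq_box.
move=> k; rewrite mem_box; apply/mapP/idP => [[i] | le_k].
  by rewrite mem_box => le_i ->; lia.
by exists (- k); rewrite ?mem_box; lia.
Qed.

Definition sgn (A : nzRingType) (k : int) : A := (-1) ^+ `|k|%N.
Arguments sgn {A} k.

Lemma sgnD (A : comNzRingType) (j k : int) : sgn (j + k) = sgn j * sgn k :> A.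
Proof. by rewrite /sgn -!(signr_odd _ `|_|) odd_absD signr_addb. Qed.

Lemma sgnN (A : comNzRingType) (k : int) : sgn (- k) = sgn k :> A.
Proof. by rewrite /sgn abszN. Qed.

Lemma sgn_sqr (A : comNzRingType) (k : int) : sgn k * sgn k = 1 :> A.
Proof. by rewrite /sgn -expr2 sqrr_sign. Qed.

Section FiniteIdentities.

Variable A : comNzRingType.
Implicit Types q z : A.

(* Shanks' identity: the difference of two consecutive right-hand sides telescopes. *)
Lemma finite_pentagonal q n :
  \sum_(k <- box n) sgn k * q ^+ pent k
  = \sum_(s < n.+1) (-1) ^+ s * (\prod_(s <= i < n) (1 - q ^+ i.+1))
                     * q ^+ (s * n + 'C(s.+1, 2)).
Proof.
elim: n => [|n IHn].
  rewrite sum_box !big_ord1 big_geq // subrr /pent /=.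
  by rewrite /sgn !expr0 !mulr1.
pose D s m : A := \prod_(s <= i < m) (1 - q ^+ i.+1).
pose a s : A := if s is s'.+1
  then (-1) ^+ s' * D s' n * q ^+ (s * n + 'C(s.+1, 2)) else 0.
have bin2S s : 'C(s.+2, 2) = ('C(s.+1, 2) + s.+1)%N by rewrite binS bin1 addnC.
rewrite sum_boxS IHn [RHS]big_ord_recr /= big_geq // mulr1.
pose t s m : A := (-1) ^+ s * D s m * q ^+ (s * m + 'C(s.+1, 2)).
have tS s : (s < n.+1)%N -> t s n.+1 = t s n - (a s.+1 - a s).
  move=> le_sn; rewrite /t /a /D big_nat_recr //=.
  case: s le_sn => [|s] lt_sn.
    rewrite !mul0n mul1n !add0n bin2S !exprD /= !expr0 expr1 exprS; ring.
  rewrite (@big_ltn _ _ _ s) //; set d := \prod_(_ <= i < n) _.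
  rewrite !mulSn mulnS (bin2S s.+1) !exprD !exprS; ring.
have -> : \sum_(s < n.+1) t s n.+1 = \sum_(s < n.+1) t s n - a n.+1.
  rewrite (eq_bigr (fun s : 'I__ => t s n - (a s.+1 - a s))) => [|s _]; last exact: tS.
  rewrite sumrB; congr (_ - _).
  rewrite -(big_mkord xpredT (fun s => a s.+1 - a s)) telescope_sumr //.
  by rewrite subr0.
rewrite -!addrA; congr (_ + _); rewrite /a /D big_geq // mulr1.
(* The leftover [- a n.+1] and the new summand s = n + 1 are the pentagonal terms at -(n + 1) and n
   + 1. *)
have e1 : (n.+1 * n + 'C(n.+2, 2))%N = pent (- n.+1%:Z).
  by have := pentE (- n.+1%:Z); have := triE n.+2%:Z; rewrite /tri; nia.
have e2 : (n.+1 * n.+1 + 'C(n.+2, 2))%N = pent n.+1%:Z.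
  by have := pentE n.+1%:Z; have := triE n.+2%:Z; rewrite /tri; nia.
rewrite e1 e2 /sgn abszN absz_nat exprS; ring.
Qed.

End FiniteIdentities.

Section FiniteJacobi.

Variable A : comNzRingType.
Implicit Types q z : A.

Lemma mul_lin_sum (c d : nat -> A) n (u v z : A) :
    c n.+1 = 0 -> d 0%N = u * c 0%N ->
    (forall k, (k <= n)%N -> d k.+1 = u * c k.+1 + v * c k) ->
  (\sum_(k < n.+1) c k * z ^+ k) * (u + v * z) = \sum_(k < n.+2) d k * z ^+ k.
Proof.
move=> c0 d0 dS.
have E : \sum_(k < n.+1) c k * z ^+ k = \sum_(k < n.+2) c k * z ^+ k.
  by rewrite [RHS]big_ord_recr /= c0 mul0r addr0.
rewrite mulrDr {1}E !mulr_suml big_ord_recl [RHS]big_ord_recl -addrA -big_split.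
congr (_ + _); first by rewrite d0 mulrAC [c _ * _]mulrC.
apply: eq_bigr => k _ /=; rewrite dS -1?ltnS // exprS; ring.
Qed.

(* The finite Jacobi triple product: as [a] and [b] tend to infinity the q-binomial
   coefficients tend to 1 / (q; q) and this is Jacobi's identity times z ^+ b. *)
Lemma finite_jacobi q z a b :
  (\prod_(k < a) (1 - z * q ^+ k)) * (\prod_(k < b) (z - q ^+ k.+1))
  = \sum_(k < (a + b).+1) ((-1) ^+ (k + b) * q ^+ tri (k%:Z - b%:Z)
                             * qbin q (a + b) k) * z ^+ k.
Proof.
have triS (i j : int) : j = i + 1 -> (tri j)%:Z = (tri i)%:Z + i.
  by move=> ->; have := triE i; have := triE (i + 1); nia.
pose w a b k := (-1) ^+ (k + b) * q ^+ tri (k%:Z - b%:Z) * qbin q (a + b) k.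
(* Outer induction on [a] by [qbinS]; the case a = 0 is an induction on [b] by the defining
   recursion of [qbin]. *)
elim: a => [|a IHa].
  rewrite big_ord0 mul1r; elim: b => [|b IHb].
    by rewrite big_ord0 big_ord1 /= !expr0 !mulr1.
  rewrite big_ord_recr /= IHb [X in _ * X](_ : _ = - q ^+ b.+1 + 1 * z); last first.
    by rewrite mul1r addrC.
  apply: (@mul_lin_sum (w 0%N b) (w 0%N b.+1)) => [||k le_kb]; rewrite /w ?add0n.
  - by rewrite qbin_small // mulr0.
  - rewrite !qbin0 !mulr1 ?add0n (_ : tri (0 - b.+1%:Z) = b.+1 + tri (0 - b%:Z))%N.
      by rewrite exprD exprS; ring.
    by have := triE (0 - b.+1%:Z); have := triE (0 - b%:Z); nia.
  rewrite -[qbin _ b.+1 _]/(qbin q b k + q ^+ k.+1 * qbin q b k.+1).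
  have -> : k.+1%:Z - b.+1%:Z = k%:Z - b%:Z by lia.
  have e : (b.+1 + tri (k.+1%:Z - b%:Z) = tri (k%:Z - b%:Z) + k.+1)%N.
    by have := triS (k%:Z - b%:Z) (k.+1%:Z - b%:Z) ltac:(lia); lia.
  transitivity ((-1) ^+ (k + b)%N * (q ^+ tri (k%:Z - b%:Z) * qbin q b k +
     q ^+ (tri (k%:Z - b%:Z) + k.+1) * qbin q b k.+1)).
    by rewrite (addSn k) (addnS k) (exprD _ _ k.+1) !(exprS (-1)); ring.
  by rewrite -e (exprD q) (addSn k) (exprS (-1)); ring.
rewrite big_ord_recr /= mulrAC IHa addSn [X in _ * X](_ : _ = 1 + (- q ^+ a) * z); last first.
  by rewrite mulrC mulNr.
apply: (@mul_lin_sum (w a b) (w a.+1 b)) => [||k le_kn]; rewrite /w ?addSn.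
- by rewrite qbin_small // mulr0.
- by rewrite !qbin0 mul1r.
rewrite qbinS //.
have e : (tri (k.+1%:Z - b%:Z) + (a + b - k) = a + tri (k%:Z - b%:Z))%N.
  by have := triS (k%:Z - b%:Z) (k.+1%:Z - b%:Z) ltac:(lia); lia.
transitivity ((-1) ^+ (k.+1 + b) * (q ^+ tri (k.+1%:Z - b%:Z) * qbin q (a + b) k.+1
   + q ^+ (tri (k.+1%:Z - b%:Z) + (a + b - k)) * qbin q (a + b) k)).
  by rewrite (exprD q); ring.
by rewrite e (exprD q) (addSn k) (exprS (-1)); ring.
Qed.

End FiniteJacobi.

Lemma qbin_polyC (A : comNzRingType) (q : A) n k : qbin q%:P n k = (qbin q n k)%:P.
Proof.
elim: n k => [|n IHn] [|k] //=.
by rewrite !IHn -polyC_exp -polyCM -polyCD.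
Qed.

(** [finite_jacobi] with z = X and a = b = m + 1 contains the factor 1 - X, from k = 0. Hence its
    value at 1 is 0 and its derivative at 1 is minus the value of the cofactor. *)
Lemma finite_jacobi_deriv (A : comNzRingType) (q : A) m :
  \sum_(n <- box m.+1) sgn n * q ^+ tri n * qbin q (m.+1 + m.+1) `|n + m.+1%:Z|
    = 0 /\
  \sum_(n <- box m.+1) sgn n * q ^+ tri n * qbin q (m.+1 + m.+1) `|n + m.+1%:Z|
      * n%:~R = - (qfact q m * qfact q m.+1).
Proof.
pose c (k : nat) := (-1) ^+ (k + m.+1) * q ^+ tri (k%:Z - m.+1%:Z) * qbin q (m.+1 + m.+1) k.
pose R : {poly A} := (\prod_(k < m) (1 - 'X * (q ^+ k.+1)%:P))
                      * \prod_(k < m.+1) ('X - (q ^+ k.+1)%:P).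
have E : (1 - 'X) * R = \sum_(k < (m.+1 + m.+1).+1) (c k)%:P * 'X^k.
  transitivity ((\prod_(k < m.+1) (1 - 'X * q%:P ^+ k))
                * (\prod_(k < m.+1) ('X - q%:P ^+ k.+1))).
    rewrite big_ord_recl expr0 mulr1 -mulrA.
    by congr (_ * (_ * _)); apply: eq_bigr => k _; rewrite polyC_exp.
  rewrite finite_jacobi; apply: eq_bigr => k _; congr (_ * _).
  by rewrite /c qbin_polyC !polyCM !polyC_exp polyCN.
have R1 : R.[1] = qfact q m * qfact q m.+1.
  rewrite /R hornerM !horner_prod; congr (_ * _); apply: eq_bigr => k _;
    by rewrite !hornerE.
have S0 : \sum_(k < (m.+1 + m.+1).+1) c k = 0.
  have := congr1 (horner^~ 1) E; rewrite hornerM hornerD hornerN hornerX hornerC.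
  rewrite subrr mul0r horner_sum => e; rewrite [RHS]e; apply: eq_bigr => k _.
  by rewrite hornerM hornerC hornerXn expr1n mulr1.
have S1 : \sum_(k < (m.+1 + m.+1).+1) c k * k%:R = - R.[1].
  have := congr1 (fun p => p^`().[1]) E; rewrite derivM derivB derivC derivX sub0r.
  rewrite hornerD !hornerM !(hornerN, hornerD, hornerX, hornerC) subrr mul0r addr0 mulN1r.
  move=> ->; rewrite linear_sum horner_sum; apply: eq_bigr => k _ /=.
  by rewrite derivM derivC mul0r add0r derivXn hornerM hornerC hornerMn hornerXn expr1n.
have sumE (w : int -> A) : \sum_(n <- box m.+1) sgn n * q ^+ tri n
      * qbin q (m.+1 + m.+1) `|n + m.+1%:Z| * w n
    = \sum_(k < (m.+1 + m.+1).+1) c k * w (k%:Z - m.+1%:Z).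
  rewrite sum_box addnn; apply: eq_bigr => k _; rewrite subrK absz_nat.
  by rewrite sgnD sgnN /sgn /c !absz_nat -exprD addnn.
split.
  apply: etrans (etrans _ (sumE (fun=> 1))) (etrans _ S0);
    by apply: eq_bigr => k _; rewrite mulr1.
rewrite (sumE (fun n => n%:~R)) -R1 -S1.
rewrite (eq_bigr (fun k : 'I__ => c k * k%:R - c k * m.+1%:R)); last first.
  by move=> k _; rewrite intrB mulrBr.
by rewrite sumrB -mulr_suml S0 mul0r subr0.
Qed.

(** * Theta series at a nilpotent argument *)

Lemma tri_large M k : (M < `|k|)%N -> (M <= tri k)%N.
Proof. by have := triE k; nia. Qed.

Lemma pent_large M k : (M < `|k|)%N -> (M <= pent k)%N.
Proof. by have := pentE k; nia. Qed.

(** The values 1, 1, 0, -1, -1, 0 of period 6: the sign with which [E] appears in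
    [sum_quadratic]. *)
Definition chi (A : nzRingType) (u : int) : A :=
  if (u %% 3)%Z == 2 then 0 else sgn (u %/ 3)%Z.
Arguments chi {A} u.

Lemma chi_int (A : comNzRingType) u : chi u = (chi u)%:~R :> A.
Proof. by rewrite /chi; case: eqP => // _; rewrite /sgn rmorphXn rmorphN. Qed.

Lemma sgn_int (A : comNzRingType) u : sgn u = (sgn u)%:~R :> A.
Proof. by rewrite /sgn rmorphXn rmorphN. Qed.

Section Nilpotent.

Variables (A : comNzRingType) (x : A) (M : nat).
Hypothesis xM0 : x ^+ M = 0.

Lemma expr_nilp n : (M <= n)%N -> x ^+ n = 0.
Proof. by move=> le_Mn; rewrite -(subnK le_Mn) exprD xM0 mulr0. Qed.

Local Notation E := (qfact x M).

Lemma qfact_nilp n : (M <= n)%N -> qfact x n = E.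
Proof.
move=> le_Mn; rewrite /qfact -!(big_mkord xpredT (fun i => 1 - x ^+ i.+1)).
rewrite (big_cat_nat (leq0n M) le_Mn) /= [X in _ * X]big_nat_cond.
rewrite [X in _ * X]big1 ?mulr1 //.
move=> i /andP[/andP[le_Mi _] _]; rewrite expr_nilp ?subr0 //.
exact: leq_trans le_Mi (leqnSn i).
Qed.

(** Each factor 1 - x^(i+1) is inverted by a geometric series, finite because [x] is nilpotent. *)
Lemma qfact_nilp_inv : exists E', E * E' = 1.
Proof.
exists (\prod_(i < M) \sum_(j < M) (x ^+ i.+1) ^+ j).
rewrite -big_split big1 //= => i _.
rewrite -[_ * _]opprK -mulNr opprB -subrX1 -exprM mulnC exprM xM0 expr0n /=.
by rewrite sub0r opprK.
Qed.

Lemma qfact_nilp_cancel a b : E * a = E * b -> a = b.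
Proof.
have [E' EE'] := qfact_nilp_inv => /(congr1 ( *%R E')).
by rewrite !mulrA [E' * _]mulrC EE' !mul1r.
Qed.

Lemma pentagonal B : (M <= B)%N -> \sum_(k <- box B) sgn k * x ^+ pent k = E.
Proof.
move=> le_MB; rewrite (sum_box_eq le_MB) => [|k lt_Mk]; last first.
  by rewrite expr_nilp ?mulr0 ?pent_large.
(* In Shanks' identity the terms with s > 0 contain x^B with B >= M, so only s = 0 survives. *)
rewrite finite_pentagonal big_ord_recl /= [X in _ + X]big1 ?addr0 => [|s _].
  by rewrite mul0n !expr0 mul1r mulr1 /qfact big_mkord.
by rewrite expr_nilp ?mulr0 // mulSn -addnA leq_addr.
Qed.

(** The coefficient of z^n in Jacobi's series T(z). *)
Definition theta n : A := sgn n * x ^+ tri n.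

Lemma theta_large n : (M < `|n|)%N -> theta n = 0.
Proof. by move=> lt_Mn; rewrite /theta expr_nilp ?mulr0 ?tri_large. Qed.

Lemma qbin_nilp k n : (M <= k)%N -> (M <= n)%N -> E * qbin x (n + k) k = 1.
Proof.
move=> le_Mk le_Mn; apply: qfact_nilp_cancel; rewrite mulr1.
have := qbin_fact x n k; rewrite !qfact_nilp // ?(leq_trans le_Mn) ?leq_addr //.
by move=> e; rewrite -[RHS]e; ring.
Qed.

(** The limit in [finite_jacobi_deriv]: at size 2 M + 1 both indices of the q-binomial are at least
    [M] when |n| <= M, so [E] cancels it; for |n| > M the power of [x] vanishes. *)
Lemma sum_theta_aux (w : int -> A) :
  E * (\sum_(n <- box M.*2.+1) sgn n * x ^+ tri n
         * qbin x (M.*2.+1 + M.*2.+1) `|n + M.*2.+1%:Z| * w n)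
  = \sum_(n <- box M) theta n * w n.
Proof.
rewrite mulr_sumr -(@sum_box_eq _ M M.*2.+1); last first.
- by move=> n lt_Mn; rewrite theta_large ?mul0r.
- lia.
apply: eq_big_seq => n; rewrite mem_box => le_n; rewrite /theta.
case: (ltnP M `|n|) => le_Mn.
  by rewrite expr_nilp ?tri_large // mulr0 !mul0r mulr0.
set k := absz (n + _); have -> : (M.*2.+1 + M.*2.+1 = absz (M.*2.+1%:Z - n) + k)%N.
  by rewrite /k; lia.
have e : E * qbin x (absz (M.*2.+1%:Z - n) + k) k = 1.
  by apply: qbin_nilp; rewrite /k; lia.
rewrite -[RHS]mulr1 -e; ring.
Qed.

Lemma sum_theta : \sum_(n <- box M) theta n = 0.
Proof.
transitivity (\sum_(n <- box M) theta n * 1); first by apply: eq_bigr => n _; rewrite mulr1.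
rewrite -(sum_theta_aux (fun=> 1)); under eq_bigr do rewrite mulr1.
by rewrite (finite_jacobi_deriv x _).1 mulr0.
Qed.

Lemma sum_theta1 : \sum_(n <- box M) theta n * n%:~R = - E ^+ 3.
Proof.
rewrite -(sum_theta_aux (fun n => n%:~R)) (finite_jacobi_deriv x _).2.
by rewrite !qfact_nilp; [ring | lia | lia].
Qed.

End Nilpotent.

Section LatticeSums.

Variables (A : comNzRingType) (x : A) (M : nat).
Hypothesis xM0 : x ^+ M = 0.
Local Notation E := (qfact x M).

(* Completing the square: modulo 3 the linear coefficient [1 - 2 * u] is 1, -1 or
   -3; the first two cases are the pentagonal series, in the last one the terms
   cancel in pairs. *)
Lemma sum_quadratic (f : int -> nat) (u c : int) :
    (forall k, (f k)%:Z * 2 = 3 * k ^+ 2 + k * (1 - 2 * u) + c) ->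
    (forall k, (M < `|k|)%N -> (M <= f k)%N) ->
  \sum_(k <- box M) sgn k * x ^+ f k = chi u * x ^+ f (u %/ 3)%Z * E.
Proof.
move=> fE fM; set a := (u %/ 3)%Z.
have F0 k : (M < `|k|)%N -> sgn k * x ^+ f k = 0.
  by move=> lt_Mk; rewrite (expr_nilp xM0) ?mulr0 ?fM.
have ua : u = a * 3 + (u %% 3)%Z by exact: divz_eq.
have := ltz_pmod u (isT : 0 < 3 :> int); have := modz_ge0 u (isT : 3 != 0 :> int).
rewrite /chi -/a; move: (u %% 3)%Z ua => r ua r_ge0 r_lt3.
have [r0|[r1|r2]] : r = 0 \/ (r = 1 \/ r = 2) by lia.
- rewrite r0 /= -(@sum_box_affine _ M (M + `|a|) _ a 1) //.
  have fa k : f (a + 1 * k) = (f a + pent k)%N.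
    suff : (f (a + 1 * k))%:Z * 2 = (f a)%:Z * 2 + (pent k)%:Z * 2 by lia.
    by rewrite !fE pentE ua r0; ring.
  rewrite (eq_bigr (fun k => (sgn a * x ^+ f a) * (sgn k * x ^+ pent k))).
    by rewrite -mulr_sumr (pentagonal xM0) // leq_addr.
  by move=> k _; rewrite fa mul1r sgnD exprD; ring.
- rewrite r1 /= -(@sum_box_affine _ M (M + `|a|) _ a (-1)) //.
  have fa k : f (a + (-1) * k) = (f a + pent k)%N.
    suff : (f (a + (-1) * k))%:Z * 2 = (f a)%:Z * 2 + (pent k)%:Z * 2 by lia.
    by rewrite !fE pentE ua r1; ring.
  rewrite (eq_bigr (fun k => (sgn a * x ^+ f a) * (sgn k * x ^+ pent k))).
    by rewrite -mulr_sumr (pentagonal xM0) // leq_addr.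
  by move=> k _; rewrite fa mulN1r sgnD sgnN exprD; ring.
rewrite r2 /= !mul0r -(@sum_box_affine _ M (M + `|a|) _ a 1) //.
(* Up to a common factor the sum is T(1) with x^3 in place of x, which is 0. *)
have fa k : f (a + 1 * k) = (f a + 3 * tri k)%N.
  suff : (f (a + 1 * k))%:Z * 2 = (f a)%:Z * 2 + 3 * ((tri k)%:Z * 2) by lia.
  by rewrite !fE triE ua r2; ring.
have x3M0 : (x ^+ 3) ^+ M = 0 by rewrite -exprM mulnC exprM xM0 expr0n.
rewrite (eq_bigr (fun k => (sgn a * x ^+ f a) * theta (x ^+ 3) k)).
  rewrite -mulr_sumr (@sum_box_eq _ M) ?leq_addr //; last exact: theta_large.
  by rewrite (sum_theta x3M0) mulr0.
by move=> k _; rewrite fa mul1r sgnD exprD exprM /theta; ring.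
Qed.

(** With b = 1 - 2 u, 24 f(k) = 12 c + (6 k + b)^2 - b^2, and 6 k + b is 1 or -1 at k = [u %/ 3] in
    the two nonvanishing cases. *)
Lemma chi_quadratic (f : int -> nat) (u c : int) :
    (forall k, (f k)%:Z * 2 = 3 * k ^+ 2 + k * (1 - 2 * u) + c) ->
  (u %% 3)%Z != 2 -> (f (u %/ 3)%Z)%:Z * 24 = 12 * c + 1 - (1 - 2 * u) ^+ 2.
Proof.
move=> fE; have := fE (u %/ 3)%Z; have := divz_eq u 3.
have := ltz_pmod u (isT : 0 < 3 :> int); have := modz_ge0 u (isT : 3 != 0 :> int).
move: (u %/ 3)%Z (u %% 3)%Z => a r r_ge0 r_lt3 ua fa r2.
have [r0|r1] : r = 0 \/ r = 1 by lia.
  by move: fa; rewrite ua r0; lia.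
by move: fa; rewrite ua r1; lia.
Qed.

End LatticeSums.

(** * Lacunary powers of Euler's product *)

(** Lacunarity expressed without coefficients, which elements of a general ring do not have. *)
Definition spanned (A : nzRingType) (x : A) (D : nat -> Prop) (a : A) : Prop :=
  exists s : seq (int * nat),
    (forall t, t \in s -> D t.2) /\ a = \sum_(t <- s) t.1%:~R * x ^+ t.2.

Section EtaPowers.

Variables (A : comNzRingType) (x : A) (M : nat).
Hypothesis xM0 : x ^+ M = 0.
Local Notation E := (qfact x M).
Local Notation bM := (box M).
Local Notation th := (theta x).

Lemma spanned0 D : spanned x D 0.
Proof. by exists [::]; rewrite big_nil. Qed.

Lemma spannedD D a b : spanned x D a -> spanned x D b -> spanned x D (a + b).
Proof.
move=> [s [sD ->]] [t [tD ->]]; exists (s ++ t); rewrite big_cat; split=> // u.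
by rewrite mem_cat => /orP[/sD | /tD].
Qed.

Lemma spanned_sum D (I : Type) (r : seq I) (F : I -> A) :
  (forall i, spanned x D (F i)) -> spanned x D (\sum_(i <- r) F i).
Proof.
by move=> DF; apply: big_ind => [||i _]; [exact: spanned0 | exact: spannedD | ].
Qed.

Lemma spanned_term (D : nat -> Prop) (w : int) e :
  (w != 0 -> D e) -> spanned x D (w%:~R * x ^+ e).
Proof.
move=> De; have [-> | w0] := eqVneq w 0; first by rewrite mul0r; exact: spanned0.
exists [:: (w, e)]; rewrite big_seq1; split=> // u.
by rewrite inE => /eqP->; exact: De.
Qed.

(** The value of (z d/dz)^p T at z = 1. *)
Definition thmom p : A := \sum_(n <- bM) theta x n * (n ^+ p)%:~R.

Lemma thmom0 : thmom 0 = 0.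
Proof. by rewrite -(sum_theta xM0); apply: eq_bigr => n _; rewrite mulr1. Qed.

Lemma thmom1 : thmom 1 = - E ^+ 3.
Proof. by rewrite -(sum_theta1 xM0). Qed.

Lemma sum_theta_lin (a b : A) :
  \sum_(n <- bM) th n * (a + n%:~R * b) = thmom 1 * b.
Proof.
transitivity (thmom 0 * a + thmom 1 * b); last by rewrite thmom0; ring.
by rewrite !mulr_suml -big_split; apply: eq_bigr => n _ /=; rewrite expr1; ring.
Qed.

Lemma thmom_shift1 (w : int) : \sum_(n <- bM) theta x n * (n + w)%:~R = thmom 1.
Proof.
transitivity (thmom 1 + w%:~R * thmom 0); last by rewrite thmom0; ring.
rewrite mulr_sumr -big_split; apply: eq_bigr => n _ /=.
by rewrite intrD; ring.
Qed.

Lemma thmom_shift2 (w : int) :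
  \sum_(n <- bM) theta x n * ((n + w) ^+ 2)%:~R = thmom 2 + w%:~R * (2 * thmom 1).
Proof.
transitivity (thmom 2 + w%:~R * (2 * thmom 1) + w%:~R ^+ 2 * thmom 0).
  rewrite !mulr_sumr -!big_split; apply: eq_bigr => n _ /=.
  by rewrite !rmorphXn !rmorphD /=; ring.
by rewrite thmom0; ring.
Qed.

Lemma thmom_shift3 (w : int) : \sum_(n <- bM) theta x n * ((n + w) ^+ 3)%:~R
  = thmom 3 + 3 * w%:~R * thmom 2 + 3 * (w ^+ 2)%:~R * thmom 1.
Proof.
transitivity (thmom 3 + 3 * w%:~R * thmom 2 + 3 * (w ^+ 2)%:~R * thmom 1
              + w%:~R ^+ 3 * thmom 0).
  rewrite !mulr_sumr -!big_split; apply: eq_bigr => n _ /=.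
  by rewrite !rmorphXn !rmorphD /=; ring.
by rewrite thmom0; ring.
Qed.

Lemma sum_shift (V : nmodType) B (F : int -> V) (a : int) :
    (M + `|a| <= B)%N -> (forall n, (M < `|n|)%N -> F n = 0) ->
  \sum_(n <- bM) F n = \sum_(n <- box B) F (n - a).
Proof.
move=> leB F0; rewrite -(@sum_box_affine _ M B F (- a) 1) ?abszN //.
by apply: eq_bigr => n _; rewrite mul1r addrC.
Qed.

(** The square of Jacobi's series for E^3, with 8 [tri m] + 1 = (2 m - 1)^2. *)
Lemma qfact6_spanned :
  spanned x (fun e => exists a b : int, e%:Z * 8 + 2 = a ^+ 2 + b ^+ 2) (E ^+ 6).
Proof.
have -> : E ^+ 6 = thmom 1 * thmom 1 by rewrite thmom1; ring.
rewrite mulr_suml; apply: spanned_sum => m; rewrite mulr_sumr.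
apply: spanned_sum => n.
have -> : theta x m * (m ^+ 1)%:~R * (theta x n * (n ^+ 1)%:~R)
    = (sgn m * sgn n * m * n)%:~R * x ^+ (tri m + tri n).
  by rewrite /theta (sgn_int _ m) (sgn_int _ n) !intrM exprD !expr1; ring.
apply: spanned_term => _; exists (2 * m - 1), (2 * n - 1).
have := triE m; have := triE n; rewrite PoszD; lia.
Qed.

Lemma qfact8_spanned :
  spanned x (fun e => exists a b : int, e%:Z * 3 + 1 = a ^+ 2 - a * b + b ^+ 2)
    (- 2 * E ^+ 8).
Proof.
have th0 n : (M < `|n|)%N -> th n = 0 by exact: theta_large.
(* The indices i, j, k belong to T(x), T(y), T(x y), and the weight is (x d/dx)^2 (y d/dy) at 1.
   Three derivatives must hit three factors vanishing there, which leaves 2 T'(1)^3. *)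
have expand : \sum_(k <- bM) \sum_(i <- bM) \sum_(j <- bM)
    th i * th j * th k * ((i + k) ^+ 2 * (j + k))%:~R = - 2 * E ^+ 9.
  transitivity (\sum_(k <- bM) th k * (thmom 2 + k%:~R * (2 * thmom 1)) * thmom 1).
    apply: eq_bigr => k _; rewrite -thmom_shift2 mulr_sumr mulr_suml.
    apply: eq_bigr => i _; rewrite -(thmom_shift1 k) mulr_sumr.
    by apply: eq_bigr => j _; rewrite intrM; ring.
  by rewrite -mulr_suml sum_theta_lin !thmom1; ring.
pose f (m n k : int) := (tri (m - k)%R + tri (n - k)%R + tri k)%N.
have fE m n k : (f m n k)%:Z * 2
    = 3 * k ^+ 2 + k * (1 - 2 * (m + n)) + (m ^+ 2 + n ^+ 2 - m - n).
  by rewrite !PoszD !mulrDl !triE; ring.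
have fM m n k : (M < `|k|)%N -> (M <= f m n k)%N.
  by move=> /tri_large lt_Mk; rewrite /f; lia.
(* The terms are collected by m = i + k and n = j + k, both in [-2 M, 2 M]; the sum over [k] then
   falls under [sum_quadratic] with u = m + n. *)
have key : - 2 * E ^+ 9 = E * \sum_(m <- box M.*2) \sum_(n <- box M.*2)
    (m ^+ 2 * n * sgn m * sgn n * chi (m + n)%R)%:~R * x ^+ f m n ((m + n)%R %/ 3)%Z.
  rewrite -expand.
  transitivity (\sum_(k <- bM) \sum_(m <- box M.*2) \sum_(n <- box M.*2)
      th (m - k) * th (n - k) * th k * (m ^+ 2 * n)%:~R).
    apply: eq_big_seq => k; rewrite mem_box => le_k.
    rewrite (@sum_shift _ M.*2 _ k); first last.
    - by move=> i /th0 thi; rewrite big1 // => j _; rewrite thi !mul0r.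
    - lia.
    apply: eq_bigr => m _; rewrite (@sum_shift _ M.*2 _ k); first last.
    - by move=> j /th0 thj; rewrite thj mulr0 !mul0r.
    - lia.
    by apply: eq_bigr => n _; rewrite !subrK.
  rewrite exchange_big mulr_sumr; apply: eq_bigr => m _ /=.
  rewrite exchange_big mulr_sumr; apply: eq_bigr => n _ /=.
  transitivity ((m ^+ 2 * n * sgn m * sgn n)%:~R * \sum_(k <- bM) sgn k * x ^+ f m n k).
    rewrite mulr_sumr; apply: eq_bigr => k _; rewrite /theta !sgnD !sgnN !exprD.
    rewrite !intrM -!sgn_int -[in RHS](mul1r (sgn k)) -(sgn_sqr A k); ring.
  rewrite (sum_quadratic xM0 (fE m n) (@fM m n)).
  by rewrite [in RHS]intrM -chi_int; ring.
have -> : - 2 * E ^+ 8 = \sum_(m <- box M.*2) \sum_(n <- box M.*2)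
    (m ^+ 2 * n * sgn m * sgn n * chi (m + n)%R)%:~R * x ^+ f m n ((m + n)%R %/ 3)%Z.
  by apply: (qfact_nilp_cancel xM0); rewrite -key; ring.
apply: spanned_sum => m; apply: spanned_sum => n; apply: spanned_term => w0.
(* By [chi_quadratic], three times the exponent is m^2 - m n + n^2 - m - n. *)
exists (m - 1), (n - 1).
have u3 : ((m + n)%R %% 3)%Z != 2.
  by apply: contra_neq w0 => u2; rewrite /chi u2 eqxx mulr0.
have := chi_quadratic (fE m n) u3; lia.
Qed.

Lemma qfact10_spanned :
  spanned x (fun e => exists a b : int, e%:Z * 24 + 10 = a ^+ 2 + b ^+ 2)
    (6 * E ^+ 10).
Proof.
have th0 n : (M < `|n|)%N -> th n = 0 by exact: theta_large.
(* Now i, j, k, l belong to T(x), T(y), T(x y), T(x / y). Four derivatives must hit four factors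
   vanishing at 1, which leaves 6 T'(1)^4. *)
have expand : \sum_(k <- bM) \sum_(l <- bM) \sum_(i <- bM) \sum_(j <- bM)
    th i * th j * th k * th l * ((i + (k + l)) ^+ 3 * (j + (k - l)))%:~R
    = 6 * E ^+ 12.
  transitivity (\sum_(k <- bM) th k * \sum_(l <- bM) th l *
     (thmom 3 + 3 * (l + k)%:~R * thmom 2 + 3 * ((l + k) ^+ 2)%:~R * thmom 1)
     * thmom 1).
    apply: eq_bigr => k _; rewrite mulr_sumr; apply: eq_bigr => l _.
    rewrite [l + k]addrC -thmom_shift3 mulr_sumr mulr_suml mulr_sumr.
    apply: eq_bigr => i _; rewrite -(thmom_shift1 (k - l)) !mulr_sumr.
    by apply: eq_bigr => j _; rewrite intrM; ring.
  transitivity (\sum_(k <- bM) th k *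
     (3 * thmom 1 ^+ 2 * thmom 2 + 3 * thmom 2 * thmom 1 ^+ 2
      + k%:~R * (6 * thmom 1 ^+ 3))).
    apply: eq_bigr => k _; congr (_ * _).
    transitivity (thmom 3 * thmom 1 * (\sum_(l <- bM) th l)
        + 3 * thmom 2 * thmom 1 * (\sum_(l <- bM) th l * (l + k)%:~R)
        + 3 * thmom 1 ^+ 2 * (\sum_(l <- bM) th l * ((l + k) ^+ 2)%:~R)).
      move: (thmom 1) (thmom 2) (thmom 3) => S1 S2 S3.
      by rewrite !mulr_sumr -!big_split; apply: eq_bigr => l _ /=; ring.
    by rewrite (sum_theta xM0) thmom_shift1 thmom_shift2; ring.
  by rewrite sum_theta_lin !thmom1; ring.
pose f (m n k l : int) := (tri (m - (k + l))%R + tri (n - (k - l))%R + tri k + tri l)%N.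
(* The cross terms k l cancel, so the sums over [l] and [k] can be evaluated one after the other.
   Reversing the sign of [l] gives its linear coefficient the form 1 - 2 u. *)
have flE m n k l : (f m n k (- l))%:Z * 2 = 3 * l ^+ 2 + l * (1 - 2 * (n - m))
    + ((m - k) ^+ 2 - (m - k) + (n - k) ^+ 2 - (n - k) + k ^+ 2 - k).
  by rewrite !PoszD !mulrDl !triE; ring.
have flM m n k l : (M < `|l|)%N -> (M <= f m n k (- l)%R)%N.
  by rewrite -abszN => /tri_large lt_Ml; rewrite /f; lia.
have fkE m n l k : (f m n k l)%:Z * 2 = 3 * k ^+ 2 + k * (1 - 2 * (m + n))
    + (m ^+ 2 - m + n ^+ 2 - n + (3 * l ^+ 2 - l * (1 + 2 * (m - n)))).
  by rewrite !PoszD !mulrDl !triE; ring.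
have fkM m n l k : (M < `|k|)%N -> (M <= f m n k l)%N.
  by move=> /tri_large lt_Mk; rewrite /f; lia.
pose e m n := f m n ((m + n)%R %/ 3)%Z (- ((n - m)%R %/ 3)%Z)%R.
pose w (m n : int) : int := m ^+ 3 * n * sgn m * sgn n * chi (m + n) * chi (n - m).
set B := (M + M.*2)%N.
have key : 6 * E ^+ 12
    = E * (E * \sum_(m <- box B) \sum_(n <- box B) (w m n)%:~R * x ^+ e m n).
  rewrite -expand.
  transitivity (\sum_(k <- bM) \sum_(l <- bM) \sum_(m <- box B) \sum_(n <- box B)
      th (m - (k + l)) * th (n - (k - l)) * th k * th l * (m ^+ 3 * n)%:~R).
    apply: eq_big_seq => k; rewrite mem_box => le_k.
    apply: eq_big_seq => l; rewrite mem_box => le_l.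
    rewrite (@sum_shift _ B _ (k + l)); first last.
    - by move=> i /th0 thi; rewrite big1 // => j _; rewrite thi !mul0r.
    - by rewrite /B; lia.
    apply: eq_bigr => m _; rewrite (@sum_shift _ B _ (k - l)); first last.
    - by move=> j /th0 thj; rewrite thj mulr0 !mul0r.
    - by rewrite /B; lia.
    by apply: eq_bigr => n _; rewrite !subrK.
  under eq_bigr do rewrite exchange_big /=; rewrite exchange_big !mulr_sumr.
  apply: eq_bigr => m _ /=; under eq_bigr do rewrite exchange_big /=.
  rewrite exchange_big !mulr_sumr; apply: eq_bigr => n _ /=.
  transitivity ((m ^+ 3 * n * sgn m * sgn n)%:~R *
      \sum_(k <- bM) sgn k * \sum_(l <- bM) sgn l * x ^+ f m n k (- l)).
    rewrite mulr_sumr; apply: eq_bigr => k _.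
    rewrite -[in RHS]sum_boxN !mulr_sumr; apply: eq_bigr => l _.
    rewrite /theta opprK !sgnD !sgnN !sgnD !sgnN !exprD.
    rewrite !intrM -!sgn_int -[in RHS](mul1r (sgn k)) -(sgn_sqr A k).
    rewrite -[in RHS](mul1r (sgn l)) -(sgn_sqr A l); ring.
  under eq_bigr do rewrite (sum_quadratic xM0 (flE m n _) (flM m n _)).
  transitivity ((m ^+ 3 * n * sgn m * sgn n)%:~R * (E * chi (n - m)) *
      \sum_(k <- bM) sgn k * x ^+ f m n k (- ((n - m)%R %/ 3)%Z)).
    by rewrite -[RHS]mulrA; congr (_ * _); rewrite mulr_sumr; apply: eq_bigr => k _; ring.
  rewrite (sum_quadratic xM0 (fkE m n _) (fkM m n _)) /w /e.
  by rewrite [in RHS]intrM [in RHS]intrM -!chi_int; ring.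
have -> : 6 * E ^+ 10 = \sum_(m <- box B) \sum_(n <- box B) (w m n)%:~R * x ^+ e m n.
  by apply: (qfact_nilp_cancel xM0); apply: (qfact_nilp_cancel xM0); rewrite -key; ring.
apply: spanned_sum => m; apply: spanned_sum => n; apply: spanned_term => w0.
(* [chi_quadratic] applied in [k] and in [l] gives 24 e = 4 (m^2 - 3 m + n^2 - n). *)
exists (2 * m - 3), (2 * n - 1).
have u3 : ((m + n)%R %% 3)%Z != 2.
  by apply: contra_neq w0 => u2; rewrite /w /chi u2 eqxx mulr0 mul0r.
have v3 : ((n - m)%R %% 3)%Z != 2.
  by apply: contra_neq w0 => v2; rewrite /w {2}/chi v2 eqxx mulr0.
rewrite [(e m n)%:Z * 24](chi_quadratic (fkE m n _) u3).
move: ((n - m)%R %/ 3)%Z (flE m n 0 ((n - m)%R %/ 3)%Z) (chi_quadratic (flE m n 0) v3).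
move=> b fb f24; rewrite mulrDr [12 * (3 * _ - _)](_ : _ = 1 - (1 - 2 * (n - m)) ^+ 2).
  by ring.
apply: (addrI (12 * ((m - 0) ^+ 2 - (m - 0) + (n - 0) ^+ 2 - (n - 0) + 0 ^+ 2 - 0))).
transitivity ((f m n 0 (- b))%:Z * 24); last by rewrite f24; ring.
by rewrite (_ : 24 = 2 * 12) // mulrA fb; ring.
Qed.

End EtaPowers.

(** * Coefficients of polynomials modulo X^(N+1) *)

Section Truncation.

Variables (R : comNzRingType) (N : nat).
Local Notation tr := (in_qpoly ('X^(N.+1) : {poly R})).

Lemma coef_trunc (p q : {poly R}) : tr p = tr q -> p`_N = q`_N.
Proof.
move=> /(congr1 val) /=; rewrite mk_monic_Xn /= -!Pdiv.RingMonic.take_poly_rmodp.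
by move=> /polyP/(_ N); rewrite !coef_take_poly ltnSn.
Qed.

Lemma trunc_Xn : tr 'X ^+ N.+1 = 0.
Proof.
rewrite -rmorphXn /=; apply: val_inj => /=.
by rewrite mk_monic_Xn /= Pdiv.RingMonic.rmodpp // monicXn.
Qed.

Lemma trunc_qfact n : tr (qfact 'X n) = qfact (tr 'X) n.
Proof.
rewrite rmorph_prod; apply: eq_bigr => i _.
by rewrite rmorphB rmorph1 rmorphXn.
Qed.

(** The combination lifts to polynomials with the same exponents, and truncation preserves the
    coefficient of X^N. *)
Lemma coef_spanned D (p : {poly R}) : spanned (tr 'X) D (tr p) -> ~ D N -> p`_N = 0.
Proof.
move=> [s [sD ps]] nDN.
have /coef_trunc -> : tr p = tr (\sum_(t <- s) t.1%:~R * 'X^(t.2)).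
  rewrite ps rmorph_sum; apply: eq_bigr => t _.
  by rewrite rmorphM rmorph_int rmorphXn.
rewrite coef_sum big_seq big1 // => t ts.
rewrite coefMXn; case: ltnP => // le_tN; rewrite -[_%:~R]mulr1.
rewrite mulrzl coefMrz coef1; case: eqP; rewrite ?mul0rz // => eN.
case: nDN; have -> : N = t.2 by apply/eqP; rewrite eqn_leq le_tN -subn_eq0 eN.
exact: sD.
Qed.

End Truncation.

Lemma coef_qfact6 N :
    ~ (exists a b : int, N%:Z * 8 + 2 = a ^+ 2 + b ^+ 2) ->
  (qfact ('X : {poly int}) N.+1 ^+ 6)`_N = 0.
Proof.
move=> nD; apply: coef_spanned nD; rewrite rmorphXn /= trunc_qfact.
exact/qfact6_spanned/trunc_Xn.
Qed.

Lemma coef_qfact8 N :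
    ~ (exists a b : int, N%:Z * 3 + 1 = a ^+ 2 - a * b + b ^+ 2) ->
  (qfact ('X : {poly int}) N.+1 ^+ 8)`_N = 0.
Proof.
move=> nD; suff : (- 2 * qfact ('X : {poly int}) N.+1 ^+ 8)`_N = 0.
  by rewrite -[- 2]/((-2 : int)%:~R) mulrzl coefMrz => /eqP; rewrite mulrz_eq0 => /eqP.
apply: coef_spanned nD; rewrite rmorphM rmorphN rmorph_nat rmorphXn /= trunc_qfact.
exact/qfact8_spanned/trunc_Xn.
Qed.

Lemma coef_qfact10 N :
    ~ (exists a b : int, N%:Z * 24 + 10 = a ^+ 2 + b ^+ 2) ->
  (qfact ('X : {poly int}) N.+1 ^+ 10)`_N = 0.
Proof.
(* Multiplication by 6 is injective on integers but not modulo 3, so vanishing is shown before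
   reduction. *)
move=> nD; suff : (6 * qfact ('X : {poly int}) N.+1 ^+ 10)`_N = 0.
  by rewrite -[6]/((6 : int)%:~R) mulrzl coefMrz => /eqP; rewrite mulrz_eq0 => /eqP.
apply: coef_spanned nD; rewrite rmorphM rmorph_nat rmorphXn /= trunc_qfact.
exact/qfact10_spanned/trunc_Xn.
Qed.

(** * Anisotropy of the norm forms *)

Lemma dvdz_Fp p (a : int) : prime p -> (p %| a)%Z = (a%:~R == 0 :> 'F_p).
Proof. by move=> p_pr; rewrite (dvdz_pcharf (pchar_Fp p_pr)). Qed.

Lemma fermat_Fp p (x : 'F_p) : prime p -> x ^+ p = x.
Proof. by move=> p_pr; rewrite -[RHS]expf_card card_Fp. Qed.

(** As 4 | q + 1, raising x^2 = - y^2 to the even power (q + 1) / 2 gives x^(q+1) = y^(q+1), which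
    is x^2 = y^2 by Fermat; so 2 y^2 = 0 with q odd. *)
Lemma sum_sqr_anisotropic q (a b : int) :
    prime q -> q = 3 %[mod 4] -> (q %| (a ^+ 2 + b ^+ 2)%R)%Z ->
  (q %| a)%Z /\ (q %| b)%Z.
Proof.
move=> q_pr q3; rewrite !dvdz_Fp // rmorphD !rmorphXn /=.
move: a%:~R b%:~R => x y; rewrite addr_eq0 => /eqP xy.
have e : x ^+ q.+1 = y ^+ q.+1.
  have -> : q.+1 = (2 * (2 * (q %/ 4).+1))%N by lia.
  by rewrite !exprM xy sqrrN.
have x2y2 : x ^+ 2 = y ^+ 2.
  by move: e; rewrite exprS [RHS]exprS !fermat_Fp.
have y2 : y ^+ 2 *+ 2 = 0 by rewrite mulr2n -{1}x2y2 xy addNr.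
have two0 : (2%:R : 'F_q) != 0.
  rewrite -(dvdn_pcharf (pchar_Fp q_pr)) dvdn_prime2 //; apply/eqP => q2.
  by rewrite q2 in q3.
have y0 : y ^+ 2 = 0.
  by apply/eqP; move/eqP: y2; rewrite -mulr_natr mulf_eq0 (negbTE two0) orbF.
by rewrite -(sqrf_eq0 x) -(sqrf_eq0 y) x2y2 y0 eqxx.
Qed.

(** The form divides x^3 + y^3, and cubing is injective on F_q because z^(2q-1) = z and 3 | 2 q - 1.
    So x = - y, and then 3 y^2 = 0 with q different from 3. *)
Lemma eisenstein_anisotropic q (a b : int) :
    prime q -> q = 2 %[mod 3] -> (q %| (a ^+ 2 - a * b + b ^+ 2)%R)%Z ->
  (q %| a)%Z /\ (q %| b)%Z.
Proof.
move=> q_pr q2; rewrite !dvdz_Fp // rmorphD rmorphB !rmorphXn rmorphM /=.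
move: a%:~R b%:~R => x y /eqP xy.
have cube : x ^+ 3 = (- y) ^+ 3.
  apply/eqP; rewrite -subr_eq0; apply/eqP.
  by transitivity ((x + y) * (x ^+ 2 - x * y + y ^+ 2)); [ring | rewrite xy mulr0].
have cubeK (z : 'F_q) : (z ^+ 3) ^+ ((q.*2.-1) %/ 3) = z.
  have -> : (z ^+ 3) ^+ ((q.*2.-1) %/ 3) = z ^+ (q.-1 + q).
    by rewrite -exprM; congr (_ ^+ _); have := prime_gt0 q_pr; lia.
  by rewrite exprD fermat_Fp // -exprSr prednK ?prime_gt0 // fermat_Fp.
have exy : x = - y by rewrite -(cubeK x) cube cubeK.
have y2 : y ^+ 2 * 3%:R = 0 by rewrite -xy exy; ring.
have three0 : (3%:R : 'F_q) != 0.
  rewrite -(dvdn_pcharf (pchar_Fp q_pr)) dvdn_prime2 //; apply/eqP => q3.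
  by rewrite q3 in q2.
have y0 : y == 0.
  by move/eqP: y2; rewrite mulf_eq0 (negbTE three0) orbF sqrf_eq0.
by rewrite exy oppr_eq0 y0.
Qed.

(** Infinite descent: [a] and [b] are multiples of [q], dividing out q^2 forces q | s, and s / q
    takes the place of [s]. *)
Lemma descent (Q : int -> int -> int) (q s : nat) (a b c : int) :
    prime q -> (forall a b, (q %| Q a b)%Z -> (q %| a)%Z /\ (q %| b)%Z) ->
    (forall a b k, Q (a * k) (b * k) = Q a b * k ^+ 2) ->
    (0 < s)%N -> ~~ (q %| c)%Z ->
  Q a b <> s%:Z ^+ 2 * q%:Z * c.
Proof.
move=> q_pr Qan Qhom; elim/ltn_ind: s a b => s IHs a b s0 qc Qab.
have q0 : q%:Z != 0 by have := prime_gt0 q_pr; lia.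
have /Qan[/dvdzP[a' ea] /dvdzP[b' eb]] : (q %| Q a b)%Z.
  by rewrite Qab; apply/dvdzP; exists (s%:Z ^+ 2 * c); ring.
move: Qab; rewrite ea eb Qhom => Qab.
have Qab' : Q a' b' * q%:Z = s%:Z ^+ 2 * c.
  by apply: (mulIf q0); rewrite -mulrA -expr2 Qab; ring.
have /dvdzP[s' es] : (q %| s%:Z)%Z.
  have : (q %| s%:Z ^+ 2 * c)%Z by rewrite -Qab' dvdz_mull.
  by move: qc; rewrite !dvdz_Fp // rmorphM rmorphXn mulf_eq0 sqrf_eq0 => /negbTE->; rewrite orbF.
have q_gt1 := prime_gt1 q_pr.
have es' : s = (`|s'| * q)%N by have := congr1 absz es; rewrite abszM.
apply: (IHs `|s'|%N _ a' b') => //.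
- by rewrite es' in s0 *; nia.
- by rewrite es' in s0; lia.
apply: (mulIf q0); rewrite Qab' es' PoszM; ring.
Qed.

(** * The generating function modulo a prime *)

Section Multiplicities.

Variables (l N : nat).
Implicit Types (g : {ffun 'I_N.+1 -> 'I_N.+1}) (k : 'I_N.+1) (s : seq nat).

Definition parts_of g : seq nat :=
  sort geq (flatten [seq nseq (g k) (k : nat) | k <- enum 'I_N.+1]).

Lemma geq_total : total geq.
Proof. by move=> m n; exact: leq_total. Qed.

Lemma count_parts g k : count_mem (k : nat) (parts_of g) = g k.
Proof.
rewrite /parts_of count_sort count_flatten sumnE 2!big_map big_enum /=.
rewrite (bigD1 k) //= count_nseq /= eqxx mul1n big1 ?addn0 // => j jk.
by rewrite count_nseq /= (inj_eq val_inj) (negbTE jk).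
Qed.

Lemma mem_parts g n : n \in parts_of g -> exists2 k : 'I_N.+1, n = k :> nat & (0 < g k)%N.
Proof.
rewrite mem_sort => /flattenP[s /mapP[k _ ->]]; rewrite mem_nseq => /andP[gk /eqP->].
by exists k.
Qed.

Lemma sumn_parts g : sumn (parts_of g) = (\sum_(k < N.+1) k * g k)%N.
Proof.
rewrite (perm_sumn (s2 := flatten [seq nseq (g k) (k : nat) | k <- enum 'I_N.+1])).
  by rewrite sumn_flatten sumnE 2!big_map big_enum; apply: eq_bigr => k _; rewrite sumn_nseq.
by rewrite perm_sort.
Qed.

Lemma parts_of_inj : injective parts_of.
Proof.
by move=> g1 g2 e; apply/ffunP => k; apply: val_inj; rewrite /= -!count_parts e.
Qed.

(** The index k = 0 is included, since [l] divides 0; this keeps the part 0 out of [parts_of g]. *)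
Definition allowed g := [forall k : 'I_N.+1, (l %| k)%N ==> (g k == 0%N :> nat)].

Lemma regular_parts g : regular_partition l (parts_of g) = allowed g.
Proof.
apply/idP/idP => [/andP[_ /allP reg] | /forallP ok].
  apply/forallP => k; apply/implyP => lk; apply/negPn/negP => gk.
  have : (k : nat) \in parts_of g by rewrite -has_pred1 has_count count_parts lt0n.
  by move/reg; rewrite lk.
have reg n : n \in parts_of g -> ~~ (l %| n)%N.
  case/mem_parts => k -> gk; apply/negP => lk.
  by have := ok k; rewrite lk /= -leqn0 leqNgt gk.
apply/andP; split; last by apply/allP.
apply/andP; split; first exact: (sort_sorted geq_total).
by apply/negP => /reg; rewrite dvdn0.
Qed.

Lemma parts_of_surj s : is_partition s -> (sumn s <= N)%N -> exists g, parts_of g = s.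
Proof.
move=> ps le_N; have /andP[sort_s _] := ps.
have le_cnt n : (count_mem n s < N.+1)%N.
  by rewrite ltnS (leq_trans (count_size _ _)) // (leq_trans (size_partition ps)).
exists [ffun k : 'I_N.+1 => inord (count_mem (k : nat) s)].
apply: (@sorted_eq _ geq) => //.
- by move=> a b c /= ba ac; exact: leq_trans ac ba.
- by move=> a b; rewrite /geq /= andbC -eqn_leq => /eqP.
- exact: sort_sorted geq_total _.
apply/allP => n _ /=; apply/eqP; case: (ltnP n N.+1) => [lt_nN | le_Nn].
  by rewrite -[n]/(nat_of_ord (Ordinal lt_nN)) count_parts ffunE inordK.
rewrite !(count_memPn _) //; apply/negP.
  by move/mem_leq_sumn => le_n; have := leq_trans le_n le_N; rewrite leqNgt le_Nn.
by case/mem_parts => k nk _; have := ltn_ord k; rewrite -nk ltnNge le_Nn.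
Qed.

End Multiplicities.

(** The term for [c] copies of the part [k] in the generating function; k = 0, a multiple of every
    [l], contributes only the 1 of c = 0. *)
Definition weight (R : nzRingType) (l : nat) (x : R) (k c : nat) : R :=
  if (l %| k)%N && (c != 0)%N then 0 else x ^+ (k * c).

(** Expanding the product yields one term per family of [r] multiplicity functions; the allowed
    families of degree [N] correspond to the multipartitions. *)
Lemma multipart_coef (R : comNzRingType) l r N :
  (multipart l r N)%:R =
  ((\prod_(k < N.+1) \sum_(c < N.+1) weight l ('X : {poly R}) k c) ^+ r)`_N.
Proof.
pose F := {ffun 'I_r -> {ffun 'I_N.+1 -> 'I_N.+1}}.
pose deg (f : F) := (\sum_i \sum_(k < N.+1) k * f i k)%N.
pose ok (f : F) := [forall i, allowed l (f i)].
have -> : multipart l r N = #|[pred f : F | ok f && (deg f == N)]|.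
  pose Psi (f : F) : r.-tuple (seq nat) := [tuple parts_of (f i) | i < r].
  rewrite cardE -(size_map Psi); apply: card_multipart.
    rewrite map_inj_uniq ?enum_uniq // => f1 f2 /eqP; rewrite eqEtuple => /forallP e.
    apply/ffunP => i; apply: parts_of_inj.
    by have /eqP := e i; rewrite !tnth_mktuple.
  have PsiP f : regular_multipartition l N (Psi f) = ok f && (deg f == N).
    rewrite /regular_multipartition; congr andb; last congr eq_op.
      rewrite /Psi /= all_map; apply/allP/forallP => [ok_f i | ok_f i _] /=.
        by have /= := ok_f i (mem_enum _ _); rewrite regular_parts.
      by rewrite regular_parts.
    rewrite /Psi /= big_map big_enum; apply: eq_bigr => i _.
    exact: sumn_parts.
  move=> L; apply/mapP/idP => [[f] | LP].
    by rewrite mem_enum inE -PsiP => fP ->.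
  have /andP[/allP regL /eqP sumL] := LP.
  have le_N i : (sumn (tnth L i) <= N)%N.
    by rewrite -sumL (big_rem (tnth L i)) ?mem_tnth //= leq_addr.
  have ex i : exists g : {ffun 'I_N.+1 -> 'I_N.+1}, parts_of g == tnth L i.
    have /andP[ps _] := regL _ (mem_tnth i L).
    by have [g <-] := parts_of_surj ps (le_N i); exists g.
  pose f : F := [ffun i => xchoose (ex i)].
  have LE : L = Psi f.
    apply: eq_from_tnth => i; rewrite tnth_mktuple ffunE.
    exact/esym/eqP/(xchooseP (ex i)).
  by exists f => //; rewrite mem_enum inE -PsiP -LE.
rewrite -[X in _ ^+ X]card_ord -prodr_const.
under [in RHS]eq_bigr do rewrite bigA_distr_bigA.
rewrite bigA_distr_bigA coef_sum -sum1_card natr_sum big_mkcond /=.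
apply: eq_bigr => f _; rewrite inE.
have -> : \prod_i \prod_(k < N.+1) weight l ('X : {poly R}) k (f i k)
    = if ok f then 'X^(deg f) else 0.
  case: ifPn => [/forallP okf | ].
    rewrite /deg -prodrXr; apply: eq_bigr => i _; rewrite -prodrXr; apply: eq_bigr => k _.
    rewrite /weight; case: ifP => // /andP[lk].
    by have /forallP/(_ k) := okf i; rewrite lk /= => ->.
  rewrite negb_forall => /existsP[i]; rewrite negb_forall => /existsP[k].
  rewrite negb_imply => lk; rewrite (bigD1 i) //= (bigD1 k) //= /weight lk.
  by rewrite !mul0r.
by case: (ok f); rewrite ?coef0 //= coefXn eq_sym; case: eqP.
Qed.

Lemma prod_multiples (R : comNzRingType) p m (F : nat -> R) : (0 < p)%N ->
  \prod_(0 <= k < p * m | (p %| k)%N) F k = \prod_(0 <= j < m) F (p * j)%N.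
Proof.
move=> p_gt0; elim: m => [|m IHm]; first by rewrite muln0 !big_geq.
have -> : (p * m.+1 = (p * m).+1 + p.-1)%N by rewrite addSnnS prednK // mulnS addnC.
rewrite big_nat_recr //= -IHm (big_cat_nat (n := (p * m)%N)) //=; last first.
  by rewrite addSnnS leq_addr.
congr (_ * _); rewrite big_ltn_cond ?leq_addr // dvdn_mulr //.
rewrite big_nat_cond big1 ?mulr1 // => k.
case/andP=> /andP[lo hi] /dvdnP[c ek].
have lt_mc : (m < c)%N by rewrite -(ltn_pmul2l p_gt0) [(p * c)%N]mulnC -ek.
have := leq_mul (leqnn p) lt_mc; rewrite [(p * c)%N]mulnC -ek mulnS; lia.
Qed.

Section ModPrime.

Variables (A : comNzRingType) (p N : nat) (x : A).
Hypotheses (p_pr : prime p) (pA : p \in [pchar A]) (xN0 : x ^+ N.+1 = 0).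

(* E_p = E_1 ^ p in characteristic p, so E_p / E_1 becomes E_1 ^ (p - 1). *)
Lemma prod_weight_pchar :
  \prod_(k < N.+1) \sum_(c < N.+1) weight p x k c = qfact x N.+1 ^+ p.-1.
Proof.
(* The value at 0 is set to 1, since 1 - x^0 = 0 would annihilate the product over multiples of
   [p]. *)
pose u k := if k == 0%N then 1 else 1 - x ^+ k.
have u_large k : (N < k)%N -> u k = 1.
  by case: k => // k lt_Nk; rewrite /u /= (expr_nilp xN0) ?subr0.
have Eu : qfact x N.+1 = \prod_(k < N.+1) u k.
  by rewrite /qfact big_ord_recr [RHS]big_ord_recl /= xN0 subr0 mulr1 mul1r.
apply: (qfact_nilp_cancel xN0); rewrite -exprS prednK ?prime_gt0 // {1}Eu mulrC -big_split.
(* For [k] prime to [p] the geometric series cancels [u k]; for p | k only c = 0 contributes and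
   [u k] stays. *)
transitivity (\prod_(k < N.+1 | (p %| k)%N) u k).
  rewrite [RHS]big_mkcond; apply: eq_bigr => k _ /=.
  case: ifP => pk.
    rewrite big_ord_recl /weight pk /= muln0 big1 ?addr0 ?mul1r // => c _.
  rewrite /u; case: eqP => k0; first by rewrite k0 dvdn0 in pk.
  rewrite (eq_bigr (fun c : 'I__ => (x ^+ k) ^+ c)) => [|c _]; last first.
    by rewrite /weight pk exprM.
  rewrite mulrC -[_ * _]opprK -mulNr opprB -subrX1 -exprM mulnC exprM xN0 expr0n /=.
  by case: (k : nat) k0 => //= _ _; rewrite sub0r opprK.
rewrite -(big_mkord (fun k => p %| k)%N u).
have p_gt0 := prime_gt0 p_pr.
(* Beyond [N] all [u k] are 1, so the range can be extended until the multiples are p j for all j <=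
   N. *)
transitivity (\prod_(0 <= k < p * N.+1 | (p %| k)%N) u k).
  rewrite [RHS](big_cat_nat (n := N.+1)) ?leq_pmull //= [X in _ = _ * X]big_nat_cond.
  by rewrite [X in _ = _ * X]big1 ?mulr1 // => k /andP[/andP[/u_large]].
rewrite prod_multiples // big_mkord Eu -prodrXl; apply: eq_bigr => j _.
rewrite /u muln_eq0 -[p == 0%N]negbK -lt0n p_gt0 /=; case: eqP => _.
  by rewrite expr1n.
rewrite mulnC exprM -(pFrobenius_autE pA (x ^+ j)) -(pFrobenius_autE pA (1 - _)).
by rewrite rmorphB rmorph1.
Qed.

End ModPrime.

(** Over F_p, f^p = f(X^p): Frobenius is additive and fixes the coefficients. *)
Lemma coef_exprp p (f : {poly 'F_p}) i : prime p -> (f ^+ p)`_(p * i) = f`_i.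
Proof.
move=> p_pr; have pP : p \in [pchar {poly 'F_p}] by rewrite pchar_poly pchar_Fp.
suff -> : f ^+ p = f \Po 'X^p.
  by rewrite coef_comp_poly_Xn ?prime_gt0 // dvdn_mulr // mulKn ?prime_gt0.
rewrite -(pFrobenius_autE pP) -{1}[f]coefK poly_def rmorph_sum comp_polyE.
apply: eq_bigr => k _; rewrite -mul_polyC rmorphM /= !pFrobenius_autE.
by rewrite -polyC_exp fermat_Fp // mul_polyC -!exprM mulnC.
Qed.

Lemma dvdn_multipart p r k N : prime p -> (p.-1 * r = p * k)%N ->
    (qfact ('X : {poly int}) N.+1 ^+ k)`_N = 0 ->
  (p %| multipart p r (p * N))%N.
Proof.
move=> p_pr rk coef0; rewrite (dvdn_pcharf (pchar_Fp p_pr)) multipart_coef.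
set G := \prod_(_ < _) _; set m := (p * N)%N.
have -> : (G ^+ r)`_m = ((qfact ('X : {poly 'F_p}) m.+1 ^+ k) ^+ p)`_m.
  apply: coef_trunc; rewrite -exprM [(k * p)%N]mulnC -rk exprM !(rmorphXn _ r).
  congr (_ ^+ r); rewrite rmorphXn /= trunc_qfact.
  rewrite -(prod_weight_pchar p_pr _ (trunc_Xn _ m)); last first.
    by rewrite pchar_qpoly pchar_Fp.
  rewrite rmorph_prod; apply: eq_bigr => i _; rewrite rmorph_sum; apply: eq_bigr => c _.
  by rewrite /weight; case: ifP; rewrite ?rmorph0 ?rmorphXn.
rewrite coef_exprp //.
have -> : (qfact ('X : {poly 'F_p}) m.+1 ^+ k)`_N = (qfact ('X : {poly 'F_p}) N.+1 ^+ k)`_N.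
  apply: coef_trunc; rewrite !rmorphXn /= !trunc_qfact.
  by rewrite (qfact_nilp (trunc_Xn _ N)) // ltnS leq_pmull ?prime_gt0.
have -> : qfact ('X : {poly 'F_p}) N.+1 = map_poly intr (qfact ('X : {poly int}) N.+1).
  rewrite rmorph_prod; apply: eq_bigr => i _.
  by rewrite rmorphB rmorph1 /= map_polyXn.
by rewrite -rmorphXn coef_map coef0 /= mulr0z eqxx.
Qed.

Lemma multipartz_mod p r k (z : int) : prime p -> (p.-1 * r = p * k)%N ->
    (forall N : nat, N%:Z = z -> (qfact ('X : {poly int}) N.+1 ^+ k)`_N = 0) ->
  multipartz p r (p%:Z * z) = 0 %[mod p].
Proof.
move=> p_pr rk; case: z => [N | N] coefN; last first.
  (* A negative [z] makes p z negative, where the count is 0 by convention. *)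
  by have -> : p%:Z * Negz N = Negz (p * N.+1).-1 by have := prime_gt0 p_pr; lia.
by rewrite mod0n; apply/eqP/(dvdn_multipart p_pr rk)/coefN.
Qed.

(** * Squares of primes modulo 3, 4 and 12, and the five congruences *)

Lemma prime_dvdz q (a b : int) : prime q -> (q %| a * b)%Z -> (q %| a)%Z || (q %| b)%Z.
Proof. by move=> q_pr; rewrite !dvdz_Fp // rmorphM mulf_eq0. Qed.

Lemma sqr_mod3 p : p = 2 %[mod 3] -> (3 %| (p%:Z ^+ 2 - 1)%R)%Z.
Proof.
move=> p2; apply/dvdzP; exists (3 * (p %/ 3)%N%:Z ^+ 2 + 4 * (p %/ 3)%N%:Z + 1).
by rewrite {1}(_ : p%:Z = 3 * (p %/ 3)%N%:Z + 2); [ring | lia].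
Qed.

Lemma sqr_mod4 p : p = 3 %[mod 4] -> (4 %| (p%:Z ^+ 2 - 1)%R)%Z.
Proof.
move=> p3; apply/dvdzP; exists (4 * (p %/ 4)%N%:Z ^+ 2 + 6 * (p %/ 4)%N%:Z + 2).
by rewrite {1}(_ : p%:Z = 4 * (p %/ 4)%N%:Z + 3); [ring | lia].
Qed.

Lemma sqr_mod12 p : prime p -> p <> 3%N -> p = 3 %[mod 4] ->
  (12 %| (p%:Z ^+ 2 - 1)%R)%Z.
Proof.
move=> p_pr pN3 p3; have nd3 : ~~ (3 %| p)%N by rewrite dvdn_prime2 //; lia.
rewrite (_ : 12 = 3 * 4) // Gauss_dvdz // sqr_mod4 // andbT.
have [p1|p2] : (p %% 3 = 1 \/ p %% 3 = 2)%N by lia.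
  apply/dvdzP; exists (3 * (p %/ 3)%N%:Z ^+ 2 + 2 * (p %/ 3)%N%:Z).
  by rewrite {1}(_ : p%:Z = 3 * (p %/ 3)%N%:Z + 1); [ring | lia].
exact: sqr_mod3.
Qed.

Theorem theorem1p1 (n t : nat) (p : 'I_t.+1 -> nat) (j : int)
    (p_prime : forall i, prime (p i))
    (p_ndvd_j : ~~ ((p ord_max)%:Z %| j)%Z) :
  let P : int := \prod_(i < t) (p (widen_ord (leqnSn t) i))%:Z ^+ 2 in
  let Q : int := \prod_(i < t.+1) (p i)%:Z ^+ 2 in
  let q : int := (p ord_max)%:Z in
  [/\ (forall i, p i = 2 %[mod 3]) ->
      multipartz 3 12 (3 * Q * n%:Z + (P * q * (q + 3 * j) - 1))
        = 0 %[mod 3],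
      (forall i, p i <> 3%N /\ p i = 3 %[mod 4]) ->
      multipartz 3 15
        (3 * Q * n%:Z + ((P * q * (5 * q + 12 * j) - 5) %/ 4)%Z)
        = 0 %[mod 3],
      (forall i, p i <> 5%N /\ p i = 2 %[mod 3]) ->
      multipartz 5 10
        (5 * Q * n%:Z + ((5 * (P * q * (q + 3 * j) - 1)) %/ 3)%Z)
        = 0 %[mod 5],
      (forall i, p i <> 7%N /\ p i = 3 %[mod 4]) ->
      multipartz 7 7
        (7 * Q * n%:Z + ((7 * (P * q * (q + 4 * j) - 1)) %/ 4)%Z)
        = 0 %[mod 7] &
      (forall i, [/\ p i <> 3%N, p i <> 11%N & p i = 3 %[mod 4]]) ->
      multipartz 11 11
        (11 * Q * n%:Z + ((11 * (P * q * (5 * q + 12 * j) - 5)) %/ 12)%Z)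
        = 0 %[mod 11]].
Proof.
move=> P Q q.
have q_pr : prime (p ord_max) := p_prime ord_max.
pose s : nat := (\prod_(i < t) p (widen_ord (leqnSn t) i))%N.
have s_gt0 : (0 < s)%N by apply: prodn_gt0 => i; exact/prime_gt0.
have Ps : P = s%:Z ^+ 2 by rewrite /P prodrXl /s -natz natr_prod; under [in RHS]eq_bigr do rewrite natz.
have QP : Q = P * q ^+ 2.
  rewrite /Q big_ord_recr /=; congr (_ * _).
(* [Q] is 1 modulo [m] like each of its factors; this makes the divisions in the arguments exact. *)
have Q1 (m : int) : (forall i, (m %| ((p i)%:Z ^+ 2 - 1)%R)%Z) -> exists c, Q = 1 + m * c.
  move=> m_sqr; suff /dvdzP[c Qc] : (m %| (Q - 1)%R)%Z by exists c; rewrite mulrC -Qc; ring.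
  apply: (big_ind (fun y => (m %| (y - 1)%R)%Z)) => // y z y1 z1.
  rewrite (_ : y * z - 1 = (y - 1) * z + (z - 1)); last by ring.
  by rewrite rpredD ?dvdz_mulr.
have ndvd (a b : int) : ~~ (q %| b)%Z -> ~~ (q %| (a * q + b * j)%R)%Z.
  move=> qb; rewrite (rpredDl _ (dvdz_mull a (dvdzz q))).
  apply/negP => qbj; case/orP: (prime_dvdz q_pr qbj); exact/negP.
(* [P] is a square, so [q] occurs in P q C to an odd power, which [descent] excludes for the norm
   form. *)
have eis (z C : int) : p ord_max = 2 %[mod 3] -> ~~ (q %| C)%Z ->
    z * 3 + 1 = P * q * C ->
    ~ exists a b : int, z * 3 + 1 = a ^+ 2 - a * b + b ^+ 2.
  move=> q2 qC zE [a [b ab]]; move: zE; rewrite ab Ps.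
  apply: (@descent (fun a b => a ^+ 2 - a * b + b ^+ 2) _ s a b C) => //.
    by move=> a' b'; exact: eisenstein_anisotropic.
  by move=> a' b' k; ring.
have sum2 (y C : int) : p ord_max = 3 %[mod 4] -> ~~ (q %| C)%Z ->
    y = P * q * C -> ~ exists a b : int, y = a ^+ 2 + b ^+ 2.
  move=> q3 qC yE [a [b ab]]; move: yE; rewrite ab Ps.
  apply: (@descent (fun a b => a ^+ 2 + b ^+ 2) _ s a b C) => //.
    by move=> a' b'; exact: sum_sqr_anisotropic.
  by move=> a' b' k; ring.
have qNdvd (C : nat) : (0 < C)%N -> (forall r, r \in primes C -> p ord_max != r) ->
    ~~ (q %| C%:Z)%Z.
  move=> C_gt0 nC; apply/negP => qC.
  have pC : p ord_max \in primes C by rewrite mem_primes q_pr C_gt0; exact: qC.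
  by have := nC _ pC; rewrite eqxx.
have q3 : p ord_max = 2 %[mod 3] -> ~~ (q %| 3)%Z.
  move=> q2; apply: qNdvd => // r; rewrite (_ : primes 3 = [:: 3]%N) // inE => /eqP->.
  by apply/eqP => e; rewrite e in q2.
have q24 : p ord_max <> 3%N -> p ord_max = 3 %[mod 4] -> ~~ (q %| 24)%Z.
  move=> qN3 q34; apply: qNdvd => // r; rewrite (_ : primes 24 = [:: 2; 3]%N) // !inE.
  by case/orP => /eqP->; apply/eqP => // q2; rewrite q2 in q34.
have q8 : p ord_max = 3 %[mod 4] -> ~~ (q %| 8)%Z.
  move=> q34; apply: qNdvd => // r; rewrite (_ : primes 8 = [:: 2]%N) // inE => /eqP->.
  by apply/eqP => e; rewrite e in q34.
split.
- move=> pP; have [c Qc] := Q1 3 (fun i => sqr_mod3 (pP i)).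
  have -> : 3 * Q * n%:Z + (P * q * (q + 3 * j) - 1) = 3%:Z * (Q * n%:Z + c + P * q * j).
    transitivity (3 * Q * n%:Z + (P * q ^+ 2 + 3 * P * q * j - 1)); first by ring.
    by rewrite -QP {2}Qc; ring.
  apply: (@multipartz_mod 3 12 8) => // N Nz; apply: coef_qfact8; rewrite Nz.
  (* As 1 + 3 c = Q, 3 z + 1 = 3 Q n + Q + 3 P q j, and Q = P q^2 lets P q be factored out. *)
  apply: (eis _ ((3 * n%:Z + 1) * q + 3 * j)) => //; first exact/ndvd/q3.
  transitivity (3 * Q * n%:Z + (1 + 3 * c) + 3 * P * q * j); first by ring.
  by rewrite -Qc QP; ring.
- move=> pP; have [c Qc] := Q1 12 (fun i => sqr_mod12 (p_prime i) (pP i).1 (pP i).2).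
  have -> : ((P * q * (5 * q + 12 * j) - 5) %/ 4)%Z = 3 * (5 * c + P * q * j).
    rewrite (_ : _ - 5 = 3 * (5 * c + P * q * j) * 4) ?mulzK //.
    transitivity (5 * (P * q ^+ 2) + 12 * P * q * j - 5); first by ring.
    by rewrite -QP Qc; ring.
  rewrite (_ : _ + _ = 3%:Z * (Q * n%:Z + 5 * c + P * q * j)); last by ring.
  apply: (@multipartz_mod 3 15 10) => // N Nz; apply: coef_qfact10; rewrite Nz.
  (* As 1 + 12 c = Q, 24 z + 10 = 24 Q n + 10 Q + 24 P q j. *)
  apply: (sum2 _ ((24 * n%:Z + 10) * q + 24 * j)) (pP ord_max).2 _ _.
    exact/ndvd/q24/(pP ord_max).2/(pP ord_max).1.
  transitivity (24 * Q * n%:Z + 10 * (1 + 12 * c) + 24 * P * q * j); first by ring.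
  by rewrite -Qc QP; ring.
- move=> pP; have [c Qc] := Q1 3 (fun i => sqr_mod3 (pP i).2).
  have -> : ((5 * (P * q * (q + 3 * j) - 1)) %/ 3)%Z = 5 * (c + P * q * j).
    rewrite (_ : 5 * _ = 5 * (c + P * q * j) * 3) ?mulzK //.
    transitivity (5 * (P * q ^+ 2 + 3 * P * q * j - 1)); first by ring.
    by rewrite -QP Qc; ring.
  rewrite (_ : _ + _ = 5%:Z * (Q * n%:Z + c + P * q * j)); last by ring.
  apply: (@multipartz_mod 5 10 8) => // N Nz; apply: coef_qfact8; rewrite Nz.
  apply: (eis _ ((3 * n%:Z + 1) * q + 3 * j)) (pP ord_max).2 _ _.
    exact/ndvd/q3/(pP ord_max).2.
  transitivity (3 * Q * n%:Z + (1 + 3 * c) + 3 * P * q * j); first by ring.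
  by rewrite -Qc QP; ring.
- move=> pP; have [c Qc] := Q1 4 (fun i => sqr_mod4 (pP i).2).
  have -> : ((7 * (P * q * (q + 4 * j) - 1)) %/ 4)%Z = 7 * (c + P * q * j).
    rewrite (_ : 7 * _ = 7 * (c + P * q * j) * 4) ?mulzK //.
    transitivity (7 * (P * q ^+ 2 + 4 * P * q * j - 1)); first by ring.
    by rewrite -QP Qc; ring.
  rewrite (_ : _ + _ = 7%:Z * (Q * n%:Z + c + P * q * j)); last by ring.
  apply: (@multipartz_mod 7 7 6) => // N Nz; apply: coef_qfact6; rewrite Nz.
  apply: (sum2 _ ((8 * n%:Z + 2) * q + 8 * j)) (pP ord_max).2 _ _.
    exact/ndvd/q8/(pP ord_max).2.
  transitivity (8 * Q * n%:Z + 2 * (1 + 4 * c) + 8 * P * q * j); first by ring.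
  by rewrite -Qc QP; ring.
move=> pP; have [c Qc] : exists c, Q = 1 + 12 * c.
  by apply: Q1 => i; have [pN3 _ p3] := pP i; exact: sqr_mod12.
have [qN3 _ q34] := pP ord_max.
have -> : ((11 * (P * q * (5 * q + 12 * j) - 5)) %/ 12)%Z = 11 * (5 * c + P * q * j).
  rewrite (_ : 11 * _ = 11 * (5 * c + P * q * j) * 12) ?mulzK //.
  transitivity (11 * (5 * (P * q ^+ 2) + 12 * P * q * j - 5)); first by ring.
  by rewrite -QP Qc; ring.
rewrite (_ : _ + _ = 11%:Z * (Q * n%:Z + 5 * c + P * q * j)); last by ring.
apply: (@multipartz_mod 11 11 10) => // N Nz; apply: coef_qfact10; rewrite Nz.
apply: (sum2 _ ((24 * n%:Z + 10) * q + 24 * j) q34).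
  exact: ndvd (q24 qN3 q34).
transitivity (24 * Q * n%:Z + 10 * (1 + 12 * c) + 24 * P * q * j); first by ring.
by rewrite -Qc QP; ring.
Qed.
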